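(* For every finite Markov chain $\mathcal{D}=(S,\mathbf{P},s_I)$, every set $G\subseteq S$ of absorbing states and every precision $\varepsilon>0$, the algorithm SVI-MC described in the context terminates, and the returned value $r$ satisfies $|r-\Pr(\lozenge G)|<\varepsilon$.
   Context: A finite Markov chain $\mathcal{D}=(S,\mathbf{P},s_I)$ has finite state set $S$, stochastic transition probabilities $\mathbf{P}\colon S\times S\to[0,1]$, initial state $s_I$; $s$ is absorbing if $\mathbf{P}(s,s)=1$. $\Pr_s$ is the probability measure on paths (infinite sequences $s_0s_1\dots$ with $\mathbf{P}(s_i,s_{i+1})>0$) starting in $s$, $\Pr=\Pr_{s_I}$; $\lozenge G$ is the set of paths visiting $G$. Algorithm SVI-MC: set $S_?=S\setminus(\{s\mid\Pr_s(\lozenge G)=0\}\cup G)$. Define $f,h\colon\mathbb{R}^S\to\mathbb{R}^S$ by $f(x)(s)=0$ if $\Pr_s(\lozenge G)=0$, $f(x)(s)=1$ if $s\in G$, $f(x)(s)=\sum_{s'}\mathbf{P}(s,s')x(s')$ if $s\in S_?$; and $h(y)(s)=0$ for $s\notin S_?$, $h(y)(s)=\sum_{s'}\mathbf{P}(s,s')y(s')$ for $s\in S_?$. Initialize $x_0$ as the indicator vector of $G$, $y_0$ as the indicator vector of $S_?$, $\ell_0=-\infty$, $u_0=+\infty$, $k=0$. Loop: $k\gets k+1$; $x_k=f(x_{k-1})$, $y_k=h(y_{k-1})$; if $y_k(s)<1$ for all $s\in S_?$, set $\ell_k=\max(\ell_{k-1},\min_{s\in S_?}\frac{x_k(s)}{1-y_k(s)})$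 and $u_k=\min(u_{k-1},\max_{s\in S_?}\frac{x_k(s)}{1-y_k(s)})$, otherwise $\ell_k=\ell_{k-1}$, $u_k=u_{k-1}$; stop as soon as $y_k(s_I)\cdot(u_k-\ell_k)<2\varepsilon$ (this product read as $0$ when $y_k(s_I)=0$), and return $r=x_k(s_I)+y_k(s_I)\cdot\frac{\ell_k+u_k}{2}$ (read as $x_k(s_I)$ when $y_k(s_I)=0$). *)

(* Defs.v *)
From HB Require Import structures.
From mathcomp Require Import all_boot all_order all_algebra.
From mathcomp Require Import all_classical all_reals all_analysis.
From mathcomp Require Import ring lra.

Set Implicit Arguments.
Unset Strict Implicit.
Unset Printing Implicit Defensive.

Import Order.TTheory GRing.Theory Num.Theory.
Import numFieldNormedType.Exports.

Local Open Scope classical_set_scope.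
Local Open Scope ring_scope.

Record markov_chain (R : realType) (S : finType) := MarkovChain {
  trans : S -> S -> R;
  trans_ge0 : forall s t, 0 <= trans s t;
  trans_sum1 : forall s, \sum_t trans s t = 1;
  init : S }.

Definition absorbing (R : realType) (S : finType) (D : markov_chain R S)
  (s : S) : Prop := trans D s s = 1.

Record mc_path (R : realType) (S : finType) (D : markov_chain R S) := McPath {
  state_at :> nat -> S;
  state_atP : forall i, 0 < trans D (state_at i) (state_at i.+1) }.

Lemma trans_succ (R : realType) (S : finType) (D : markov_chain R S) (s : S) :
  exists t, 0 < trans D s t.
Proof.
apply: contrapT => /forallNP H.
have := trans_sum1 D s; rewrite big1 => [/eqP|t _].
  by rewrite eq_sym oner_eq0.
by apply/eqP; rewrite eq_le trans_ge0 andbT leNgt; apply/negP/H.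
Qed.

Definition some_succ (R : realType) (S : finType) (D : markov_chain R S)
  (s : S) : S := projT1 (cid (trans_succ D s)).

Definition some_path (R : realType) (S : finType) (D : markov_chain R S) :
  mc_path D :=
  McPath (state_at := fun i => iter i (some_succ D) (init D))
    (fun i => projT2 (cid (trans_succ D (iter i (some_succ D) (init D))))).

HB.instance Definition _ (R : realType) (S : finType) (D : markov_chain R S) :=
  gen_eqMixin (mc_path D).
HB.instance Definition _ (R : realType) (S : finType) (D : markov_chain R S) :=
  gen_choiceMixin (mc_path D).
HB.instance Definition _ (R : realType) (S : finType) (D : markov_chain R S) :=
  isPointed.Build (mc_path D) (some_path D).

(* The paths whose first n.+1 states are w 0, ..., w n. *)
Definition cylinder (R : realType) (S : finType) (D : markov_chain R S)
  (w : nat -> S) (n : nat) : set (mc_path D) :=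
  [set p | forall i, (i <= n)%N -> p i = w i].
Arguments cylinder {R S} D w n.

Definition cylinders (R : realType) (S : finType) (D : markov_chain R S) :
  set (set (mc_path D)) :=
  [set C | exists w n, C = cylinder D w n].
Arguments cylinders {R S} D.

Definition path_space (R : realType) (S : finType) (D : markov_chain R S) :=
  g_sigma_algebraType (cylinders D).

Definition is_path_measure (R : realType) (S : finType) (D : markov_chain R S)
  (s : S) (mu : set (path_space D) -> \bar R) : Prop :=
  forall w n, mu (cylinder D w n) =
    ((w 0%N == s)%:R * \prod_(i < n) trans D (w i) (w i.+1))%:E.

(* Existence of the path measure: a uniform u in [0, 1[ is mapped to the path
   whose prefixes have nested subintervals [lo, lo + wd[ containing u, each
   interval being cut in proportion to the transition probabilities. *)
Definition cumul (R : realType) (S : finType) (D : markov_chain R S)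
  (s t : S) : R :=
  \sum_(t' | (enum_rank t' < enum_rank t)%N) trans D s t'.

Lemma cumul_lt (R : realType) (S : finType) (D : markov_chain R S) (s t t' : S) :
  (enum_rank t < enum_rank t')%N -> cumul D s t + trans D s t <= cumul D s t'.
Proof.
move=> tt'; rewrite /cumul addrC [leRHS](bigD1 t) //= lerD2l.
rewrite big_mkcond [leRHS]big_mkcond /=; apply: ler_sum => a _.
have := trans_ge0 D s a.
case: ifP => [at_|]; last by case: ifP.
have -> : (enum_rank a < enum_rank t')%N by exact: ltn_trans tt'.
by have -> // : a != t by apply: contraTN at_ => /eqP ->; rewrite ltnn.
Qed.

Lemma cumul_le1 (R : realType) (S : finType) (D : markov_chain R S) (s t : S) :
  cumul D s t + trans D s t <= 1.
Proof.
rewrite addrC -(trans_sum1 D s) (bigD1 t) //= lerD2l /cumul.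
rewrite big_mkcond [leRHS]big_mkcond /=; apply: ler_sum => x _.
have := trans_ge0 D s x.
case: ifP => [xl|_]; last by case: ifP.
by have -> // : x != t by apply: contraTN xl => /eqP ->; rewrite ltnn.
Qed.

Lemma cumul_inj (R : realType) (S : finType) (D : markov_chain R S)
  (s t t' : S) (v : R) :
  cumul D s t <= v < cumul D s t + trans D s t ->
  cumul D s t' <= v < cumul D s t' + trans D s t' -> t = t'.
Proof.
move=> /andP[a b] /andP[a' b'].
have [/(cumul_lt D s)|/(cumul_lt D s)|] := ltngtP (enum_rank t) (enum_rank t').
- by move=> ?; exfalso; lra.
- by move=> ?; exfalso; lra.
- by move=> /val_inj/enum_rank_inj.
Qed.

Lemma cumul_ex (R : realType) (S : finType) (D : markov_chain R S)
  (s : S) (v : R) :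
  0 <= v < 1 -> exists t, cumul D s t <= v < cumul D s t + trans D s t.
Proof.
move=> /andP[v0 v1].
have [t0 vt0 mint0] : exists2 t : S, v < cumul D s t + trans D s t &
    forall t' : S, v < cumul D s t' + trans D s t' ->
      (enum_rank t <= enum_rank t')%N.
  have [t vt] : exists t, v < cumul D s t + trans D s t.
    have S0 : (0 < #|S|)%N by apply/card_gt0P; exists s.
    have lS : (#|S|.-1 < #|S|)%N by rewrite prednK.
    exists (enum_val (Ordinal lS)).
    rewrite addrC /cumul enum_valK.
    apply: lt_le_trans v1 _; rewrite -(trans_sum1 D s).
    rewrite (bigD1 (enum_val (Ordinal lS))) //= lerD2l le_eqVlt.
    apply/orP; left; apply/eqP; apply: eq_bigl => a.
    rewrite ltn_neqAle -[X in (_ <= X)%N]/(#|S|.-1) -ltnS prednK // ltn_ord andbT.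
    congr negb; apply/eqP/eqP => [->|aS]; first by rewrite enum_valK.
    by rewrite -(enum_rankK a); congr enum_val; exact/val_inj.
  case: (@arg_minnP _ t (fun t => v < cumul D s t + trans D s t)
    (fun t => nat_of_ord (enum_rank t)) vt) => t1 vt1 mint1.
  by exists t1.
exists t0; rewrite vt0 andbT leNgt; apply/negP => vc.
have [r0|r0] := posnP (enum_rank t0).
  move: vc; rewrite /cumul big_pred0 ?ltNge ?v0 // => a.
  by rewrite r0 ltn0.
have lr : ((enum_rank t0).-1 < #|S|)%N.
  by rewrite (leq_ltn_trans (leq_pred _)).
have := mint0 (enum_val (Ordinal lr)).
rewrite enum_valK /= leqNgt prednK // leqnn /= => /(_ _)/negP; apply => //.
apply: lt_le_trans vc _.
rewrite {1}/cumul (bigD1 (enum_val (Ordinal lr))) /=; last first.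
  by rewrite enum_valK /= prednK.
rewrite addrC lerD2r /cumul enum_valK /=.
rewrite le_eqVlt; apply/orP; left; apply/eqP; apply: eq_bigl => a.
rewrite [RHS]ltn_neqAle -[in RHS]ltnS prednK // andbC; congr (_ && _).
congr negb; apply/eqP/eqP => [->|aS]; first by rewrite enum_valK.
by rewrite -(enum_rankK a); congr enum_val; exact/val_inj.
Qed.

Definition next_state (R : realType) (S : finType) (D : markov_chain R S)
  (s : S) (v : R) : S :=
  odflt s [pick t | cumul D s t <= v < cumul D s t + trans D s t].

Lemma next_stateP (R : realType) (S : finType) (D : markov_chain R S)
  (s : S) (v : R) : 0 <= v < 1 ->
  cumul D s (next_state D s v) <= v <
    cumul D s (next_state D s v) + trans D s (next_state D s v).
Proof.
move=> /(cumul_ex D s)[t tP]; rewrite /next_state; case: pickP => //=.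
by move=> /(_ t); rewrite tP.
Qed.

Fixpoint lo (R : realType) (S : finType) (D : markov_chain R S)
  (w : nat -> S) (n : nat) : R :=
  if n is m.+1 then
    lo D w m + (\prod_(i < m) trans D (w i) (w i.+1)) * cumul D (w m) (w m.+1)
  else 0.

Definition wd (R : realType) (S : finType) (D : markov_chain R S)
  (w : nat -> S) (n : nat) : R := \prod_(i < n) trans D (w i) (w i.+1).

Lemma wd_recr (R : realType) (S : finType) (D : markov_chain R S)
  (w : nat -> S) (n : nat) :
  wd D w n.+1 = wd D w n * trans D (w n) (w n.+1).
Proof. exact: big_ord_recr. Qed.

(* current state, left end and width of the current interval *)
Fixpoint gen (R : realType) (S : finType) (D : markov_chain R S) (s : S) (u : R)
  (n : nat) : S * R * R :=
  if n is m.+1 then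
    let: (c, l, d) := gen D s u m in
    let t := next_state D c ((u - l) / d) in
    (t, l + d * cumul D c t, d * trans D c t)
  else (s, 0, 1).

Lemma gen_inv (R : realType) (S : finType) (D : markov_chain R S) (s : S)
  (u : R) : 0 <= u < 1 -> forall n,
  (gen D s u n).1.2 <= u < (gen D s u n).1.2 + (gen D s u n).2.
Proof.
move=> u01; elim=> [|n] /=; first by rewrite add0r.
case: (gen D s u n) => [[c l] d] /= /andP[lu ud].
have d0 : 0 < d by lra.
have /(next_stateP D c) : 0 <= (u - l) / d < 1.
  by rewrite divr_ge0 ?ltr_pdivrMr//=; lra.
set t := next_state _ _ _.
by rewrite ler_pdivlMr // ltr_pdivrMr // => /andP[? ?]; apply/andP; split; lra.
Qed.

Lemma gen_pos (R : realType) (S : finType) (D : markov_chain R S) (s : S)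
  (u : R) : 0 <= u < 1 -> forall n,
  0 < trans D (gen D s u n).1.1 (gen D s u n.+1).1.1.
Proof.
move=> u01 n; have /= := gen_inv D s u01 n.
case: (gen D s u n) => [[c l] d] /= /andP[lu ud].
have d0 : 0 < d by lra.
have /(next_stateP D c) : 0 <= (u - l) / d < 1.
  by rewrite divr_ge0 ?ltr_pdivrMr//=; lra.
by move=> /andP[a b]; have := le_lt_trans a b; rewrite ltrDl.
Qed.

Lemma gen_lo (R : realType) (S : finType) (D : markov_chain R S) (s : S)
  (u : R) (w : nat -> S) (n : nat) :
  (forall i, (i <= n)%N -> (gen D s u i).1.1 = w i) ->
  gen D s u n = (w n, lo D w n, wd D w n).
Proof.
elim: n => [|n IH] H /=.
  by rewrite /wd big_ord0 -(H 0%N).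
have E := IH (fun i ni => H i (leqW ni)).
have := H n.+1 (leqnn _); rewrite /= E /= => ->.
by rewrite /wd big_ord_recr.
Qed.

Lemma gen_cylinder (R : realType) (S : finType) (D : markov_chain R S) (s : S)
  (u : R) (w : nat -> S) (n : nat) : 0 <= u < 1 -> w 0%N = s ->
  (forall i, (i <= n)%N -> (gen D s u i).1.1 = w i) <->
  lo D w n <= u < lo D w n + wd D w n.
Proof.
move=> u01 w0; split=> [H|].
  by have := gen_inv D s u01 n; rewrite (gen_lo H).
elim: n => [_ i|n IH /= /andP[a b]].
  by rewrite leqn0 => /eqP ->.
have wd0 : 0 <= wd D w n by apply: prodr_ge0 => i _; exact: trans_ge0.
have c0 : 0 <= cumul D (w n) (w n.+1).
  by apply: sumr_ge0 => i _; exact: trans_ge0.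
have c1 := cumul_le1 D (w n) (w n.+1).
move: a b; rewrite -/(wd D w n) => a.
rewrite wd_recr => b.
have I : lo D w n <= u < lo D w n + wd D w n.
  apply/andP; split; first by rewrite (le_trans _ a)// lerDl mulr_ge0.
  by apply: (lt_le_trans b); rewrite -addrA lerD2l -mulrDr ler_piMr.
have {}IH := IH I.
move=> i; rewrite leq_eqVlt => /predU1P[->|]; last by rewrite ltnS; exact: IH.
rewrite /= (gen_lo IH) /=.
have d0 : 0 < wd D w n by case/andP: I; lra.
have v01 : 0 <= (u - lo D w n) / wd D w n < 1.
  by case/andP: I => ? ?; rewrite divr_ge0 ?ltr_pdivrMr//=; lra.
apply: cumul_inj (next_stateP D (w n) v01) _.
by rewrite ler_pdivlMr // ltr_pdivrMr //; apply/andP; split; lra.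
Qed.

Definition gen_path (R : realType) (S : finType) (D : markov_chain R S) (s : S)
  (u : R) : path_space D :=
  match pselect (0 <= u < 1) with
  | left u01 => McPath (gen_pos D s u01)
  | right _ => some_path D
  end.

Lemma lo_itv (R : realType) (S : finType) (D : markov_chain R S)
  (w : nat -> S) (n : nat) : 0 <= lo D w n /\ lo D w n + wd D w n <= 1.
Proof.
elim: n => [|n [l0 l1]] /=; first by rewrite /wd big_ord0 add0r.
have wd0 : 0 <= wd D w n by apply: prodr_ge0 => i _; exact: trans_ge0.
have c0 : 0 <= cumul D (w n) (w n.+1).
  by apply: sumr_ge0 => i _; exact: trans_ge0.
have c1 := cumul_le1 D (w n) (w n.+1).
rewrite -/(wd D w n) wd_recr; split; first nra.
by rewrite -addrA -mulrDr (le_trans _ l1)// lerD2l ler_piMr.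
Qed.

Lemma gen_path_preimage (R : realType) (S : finType) (D : markov_chain R S)
  (s : S) (w : nat -> S) (n : nat) :
  `[0, 1[%classic `&` gen_path D s @^-1` cylinder D w n =
  if w 0%N == s then `[lo D w n, lo D w n + wd D w n[%classic else set0.
Proof.
apply/seteqP; split=> u /=.
  rewrite in_itv /= => -[u01]; rewrite /gen_path; case: pselect => // u01'.
  rewrite /cylinder /= => H.
  have w0 : w 0%N = s by rewrite -(H 0%N).
  by rewrite w0 eqxx /= in_itv /=; exact/(gen_cylinder D n u01 w0).
case: ifPn => [/eqP w0|//]; rewrite /= in_itv /= => /[dup] I /andP[a b].
have [l0 l1] := lo_itv D w n.
have u01 : 0 <= u < 1 by apply/andP; split; lra.
rewrite in_itv /= u01; split=> //; rewrite /gen_path; case: pselect => // u01'.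
by rewrite /cylinder /=; exact/(gen_cylinder D n u01 w0).
Qed.

Lemma measurable_gen_path (R : realType) (S : finType) (D : markov_chain R S)
  (s : S) (A : set (path_space D)) : measurable A ->
  measurable (`[0%R, 1%R[%classic `&` gen_path D s @^-1` A : set R).
Proof.
move=> mA; have m01 : measurable (`[0%R, 1%R[%classic : set R) by [].
apply: (@measurability _ _ _ _ _ (gen_path D s) (cylinders D)) => //.
move=> _ [_ [w [n ->]] <-].
by rewrite gen_path_preimage; case: ifP.
Qed.

Definition path_fun (R : realType) (S : finType) (D : markov_chain R S) (s : S)
  (A : set (path_space D)) : \bar R :=
  lebesgue_measure (`[0, 1[%classic `&` gen_path D s @^-1` A : set R).

Lemma path_fun0 (R : realType) (S : finType) (D : markov_chain R S) (s : S) :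
  path_fun s (set0 : set (path_space D)) = 0%E.
Proof. by rewrite /path_fun preimage_set0 setI0 measure0. Qed.

Lemma path_fun_ge0 (R : realType) (S : finType) (D : markov_chain R S) (s : S)
  (A : set (path_space D)) : (0 <= path_fun s A)%E.
Proof. exact: measure_ge0. Qed.

Lemma path_fun_sigma_additive (R : realType) (S : finType)
  (D : markov_chain R S) (s : S) : semi_sigma_additive (@path_fun R S D s).
Proof.
move=> F mF tF mUF; rewrite /path_fun preimage_bigcup setI_bigcupr.
apply: measure_semi_sigma_additive.
- by move=> n; exact: measurable_gen_path.
- apply/trivIsetP => /= i j _ _ ij.
  rewrite setIACA setIid -preimage_setI.
  by move/trivIsetP : tF => /(_ _ _ _ _ ij) ->//; rewrite preimage_set0 setI0.
- by rewrite -setI_bigcupr -preimage_bigcup; exact: measurable_gen_path.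
Qed.

HB.instance Definition _ (R : realType) (S : finType) (D : markov_chain R S)
  (s : S) := isMeasure.Build _ _ _ (@path_fun R S D s) (path_fun0 D s)
    (@path_fun_ge0 R S D s) (@path_fun_sigma_additive R S D s).

Lemma path_fun_setT (R : realType) (S : finType) (D : markov_chain R S)
  (s : S) : path_fun s [set: path_space D] = 1%E.
Proof.
rewrite /path_fun preimage_setT setIT lebesgue_measure_itv /=.
by rewrite lte_fin ltr01 sube0.
Qed.

HB.instance Definition _ (R : realType) (S : finType) (D : markov_chain R S)
  (s : S) := Measure_isProbability.Build _ _ _ (@path_fun R S D s)
    (path_fun_setT D s).

Lemma path_measure_exists (R : realType) (S : finType) (D : markov_chain R S)
  (s : S) : exists mu : probability (path_space D) R, is_path_measure s mu.
Proof.
exists (@path_fun R S D s) => w n /=.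
rewrite /path_fun gen_path_preimage; case: ifPn => [_|_]; last first.
  by rewrite measure0 mul0r.
rewrite mul1r lebesgue_measure_itv /= lte_fin ltrDl -EFinB addrAC subrr add0r.
rewrite -/(wd D w n); case: ltP => // wd0; congr EFin; apply/eqP.
by rewrite eq_le wd0 andbT; apply: prodr_ge0 => i _; exact: trans_ge0.
Qed.

(* Pr_s: the is_path_measure property determines it, since the nonempty
   cylinders together with the empty set form a pi-system generating the
   sigma-algebra. *)
Definition path_measure (R : realType) (S : finType) (D : markov_chain R S)
  (s : S) : probability (path_space D) R :=
  projT1 (cid (path_measure_exists D s)).

Lemma path_measureP (R : realType) (S : finType) (D : markov_chain R S)
  (s : S) : is_path_measure s (path_measure D s).
Proof. exact: projT2 (cid (path_measure_exists D s)). Qed.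

Definition reach (R : realType) (S : finType) (D : markov_chain R S)
  (G : {set S}) : set (path_space D) :=
  [set p : mc_path D | exists i, p i \in G].
Arguments reach {R S} D G.

Definition reach_prob (R : realType) (S : finType) (D : markov_chain R S)
  (G : {set S}) (s : S) : \bar R := path_measure D s (reach D G).

Definition S_zero (R : realType) (S : finType) (D : markov_chain R S)
  (G : {set S}) : {set S} := finset (fun s => reach_prob D G s == 0%E).

Definition S_unknown (R : realType) (S : finType) (D : markov_chain R S)
  (G : {set S}) : {set S} := ([set: S] :\: (S_zero D G :|: G))%SET.

Definition svi_f (R : realType) (S : finType) (D : markov_chain R S)
  (G : {set S}) (x : S -> R) : S -> R := fun s =>
  if s \in S_zero D G then 0
  else if s \in G then 1
  else \sum_t trans D s t * x t.

Definition svi_h (R : realType) (S : finType) (D : markov_chain R S)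
  (G : {set S}) (y : S -> R) : S -> R := fun s =>
  if s \in S_unknown D G then \sum_t trans D s t * y t else 0.

Definition svi_x (R : realType) (S : finType) (D : markov_chain R S)
  (G : {set S}) (k : nat) : S -> R :=
  iter k (svi_f D G) (fun s => (s \in G)%:R).

Definition svi_y (R : realType) (S : finType) (D : markov_chain R S)
  (G : {set S}) (k : nat) : S -> R :=
  iter k (svi_h D G) (fun s => (s \in S_unknown D G)%:R).

(* The pair (l_k, u_k). The extremum over an empty S_unknown is +oo (min) or
   -oo (max); it is irrelevant, as then svi_y vanishes everywhere. *)
Fixpoint svi_bounds (R : realType) (S : finType) (D : markov_chain R S)
  (G : {set S}) (k : nat) : \bar R * \bar R :=
  if k is j.+1 then
    let: (l, u) := svi_bounds D G j in
    let x := svi_x D G k in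
    let y := svi_y D G k in
    if [forall s in S_unknown D G, y s < 1] then
      (Order.max l
         (\big[Order.min/+oo%E]_(s in S_unknown D G) (x s / (1 - y s))%:E),
       Order.min u
         (\big[Order.max/-oo%E]_(s in S_unknown D G) (x s / (1 - y s))%:E))
    else (l, u)
  else (-oo%E, +oo%E).

Definition svi_l (R : realType) (S : finType) (D : markov_chain R S)
  (G : {set S}) (k : nat) : \bar R := (svi_bounds D G k).1.

Definition svi_u (R : realType) (S : finType) (D : markov_chain R S)
  (G : {set S}) (k : nat) : \bar R := (svi_bounds D G k).2.

(* In \bar R, 0 * +oo = 0 * -oo = 0, so both products below are 0 whenever
   svi_y D G k (init D) = 0. *)
Definition svi_stop (R : realType) (S : finType) (D : markov_chain R S)
  (G : {set S}) (eps : R) (k : nat) : bool :=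
  ((svi_y D G k (init D))%:E * (svi_u D G k - svi_l D G k) < (2 * eps)%:E)%E.

Definition svi_result (R : realType) (S : finType) (D : markov_chain R S)
  (G : {set S}) (k : nat) : \bar R :=
  ((svi_x D G k (init D))%:E +
   (svi_y D G k (init D))%:E * ((svi_l D G k + svi_u D G k) * (2^-1)%:E))%E.

(* The algorithm terminates with output r: the loop body runs at least once,
   and the loop is left at the first k >= 1 passing the test. *)
Definition svi_returns (R : realType) (S : finType) (D : markov_chain R S)
  (G : {set S}) (eps : R) (r : \bar R) : Prop :=
  exists k, [/\ (0 < k)%N, svi_stop D G eps k,
    forall j, (0 < j < k)%N -> ~~ svi_stop D G eps j & r = svi_result D G k].

(* Main.v *)
(* Write p(s) for Pr_s(reach G). The iterate x_k(s) is the probability of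
   reaching G within k steps, so it increases to p(s), and p is a fixed point
   of f by passing to the limit. As y_k(s) is the weight of the paths still in
   S_unknown after k steps, a <= p <= b on S_unknown gives
   x_k + y_k a <= p <= x_k + y_k b. Taking a and b to be the extrema of p on
   S_unknown shows l_k <= p <= u_k there, so the midpoint returned is at
   distance at most y_k (u_k - l_k) / 2 < eps from p. For termination,
   x_k + y_k <= 1 and p > 0 on S_unknown yield N with y_N < 1 on S_unknown;
   hence l_N and u_N are finite and y_k decays geometrically. *)
Require Import Defs.
From mathcomp Require Import all_boot all_order all_algebra.
From mathcomp Require Import all_classical all_reals all_analysis.
From mathcomp Require Import lra.

Set Implicit Arguments.
Unset Strict Implicit.
Unset Printing Implicit Defensive.

Import Order.TTheory GRing.Theory Num.Theory.
Import numFieldNormedType.Exports.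
Local Open Scope classical_set_scope.
Local Open Scope ring_scope.

(** * Step-bounded reachability and its path measure *)

Fixpoint reach_within (R : realType) (S : finType) (D : markov_chain R S)
  (G : {set S}) (n : nat) (s : S) : R :=
  if s \in G then 1
  else if n is m.+1 then \sum_t trans D s t * reach_within D G m t else 0.

(** The offset [m] serves the induction in [cylinder_hits]: fixing one more state of the prefix
    moves the time window by one. *)
Definition hits (R : realType) (S : finType) (D : markov_chain R S)
  (G : {set S}) (m n : nat) : set (path_space D) :=
  [set p : mc_path D | exists2 i, (i <= n)%N & p (m + i)%N \in G].
Arguments hits {R S} D G m n.

Lemma measurable_cylinder (R : realType) (S : finType) (D : markov_chain R S)
  (w : nat -> S) (n : nat) :
  measurable (cylinder D w n : set (path_space D)).
Proof. by apply: sub_sigma_algebra; exists w, n. Qed.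

Lemma measure_bigcup_finType d (T : measurableType d) (R : realType)
  (mu : {measure set T -> \bar R}) (I : finType) (F : I -> set T) :
  (forall i, measurable (F i)) -> trivIset setT F ->
  measurable (\bigcup_i F i) /\ mu (\bigcup_i F i) = (\sum_i mu (F i))%E.
Proof.
move=> mF tF; have fI : finite_set [set: I] by exact: finite_finset.
split; first exact: fin_bigcup_measurable.
have IE : [set: I] = [set` index_enum I].
  by apply/seteqP; split=> i //= _; exact: mem_index_enum.
rewrite measure_fin_bigcup // {1}IE.
by apply/esym/fsbig_seq; exact: index_enum_uniq.
Qed.

Definition extend (S : finType) (w : nat -> S) (m : nat) (t : S) : nat -> S :=
  fun i => if (i <= m)%N then w i else t.

(** This is the Markov property: given the prefix, the future depends only on its last state. The
    induction on [n] ranges over all prefixes, since its step lengthens the prefix. *)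
Lemma cylinder_hits (R : realType) (S : finType) (D : markov_chain R S)
  (G : {set S}) (s : S) (n : nat) : forall (w : nat -> S) (m : nat),
  measurable (cylinder D w m `&` hits D G m n : set (path_space D)) /\
  path_measure D s (cylinder D w m `&` hits D G m n) =
  (path_measure D s (cylinder D w m) * (reach_within D G n (w m))%:E)%E.
Proof.
have hitG n' w m : w m \in G ->
    cylinder D w m `&` hits D G m n' = cylinder D w m.
  move=> wG; apply/seteqP; split=> [p []//|p pw]; split=> //.
  by exists 0%N => //; rewrite addn0 pw.
elim: n => [|n IH] w m /=; case: ifPn => wG.
- by rewrite hitG // mule1; split=> //; exact: measurable_cylinder.
- have -> : cylinder D w m `&` hits D G m 0 = set0.
    apply/seteqP; split=> // p [pw [i]]; rewrite leqn0 => /eqP ->.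
    by rewrite addn0 pw // (negbTE wG).
  by rewrite measure0 mule0.
- by rewrite hitG // mule1; split=> //; exact: measurable_cylinder.
(* Time [m] misses [G], so a hit must occur in the window of length [n] starting at [m.+1]; the
   event splits disjointly by the state at that time. *)
have -> : cylinder D w m `&` hits D G m n.+1 =
    \bigcup_t (cylinder D (extend w m t) m.+1 `&` hits D G m.+1 n).
  apply/seteqP; split=> [p [pw [[|i] lin piG]]|p [t _ [pw [i lin piG]]]].
  - by move: piG; rewrite addn0 pw // (negbTE wG).
  - exists (p m.+1) => //; split; last by exists i => //; rewrite addSnnS.
    move=> j; rewrite /extend leq_eqVlt ltnS => /predU1P[->|jm].
      by rewrite ltnn.
    by rewrite jm pw.
  - split; last by exists i.+1 => //; rewrite -addSnnS.
    by move=> j jm; rewrite pw ?leqW // /extend jm.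
have [|| mU muU] := measure_bigcup_finType (path_measure D s)
  (F := fun t => cylinder D (extend w m t) m.+1 `&` hits D G m.+1 n).
- by move=> t; have [] := IH (extend w m t) m.+1.
- apply/trivIsetP => t t' _ _ /eqP tt'; apply/seteqP; split=> // p.
  move=> [[/(_ _ (leqnn _)) pt _] [/(_ _ (leqnn _)) pt' _]]; apply: tt'.
  by move: pt; rewrite pt' /extend ltnn.
split; rewrite // muU.
rewrite (eq_bigr (fun t => (path_measure D s (cylinder D w m) *
   (trans D (w m) t * reach_within D G n t)%:E)%E)); last first.
  move=> t _ /=; have [_ ->] := IH (extend w m t) m.+1.
  rewrite !path_measureP /extend leq0n ltnn -!EFinM big_ord_recr /= leqnn ltnn.
  rewrite -!mulrA; congr (_ * (_ * _))%:E.
  by apply: eq_bigr => i _; rewrite ltn_ord (ltnW (ltn_ord i)).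
by rewrite !path_measureP -EFinM mulr_sumr -sumEFin; apply: eq_bigr.
Qed.

(** Split by the initial state: all one-state cylinders except that of [s] are null. *)
Lemma measure_hits (R : realType) (S : finType) (D : markov_chain R S)
  (G : {set S}) (s : S) (n : nat) :
  measurable (hits D G 0 n) /\
  path_measure D s (hits D G 0 n) = (reach_within D G n s)%:E.
Proof.
have E : hits D G 0 n =
    \bigcup_t (cylinder D (fun=> t) 0 `&` hits D G 0 n).
  rewrite -setI_bigcupl; apply/seteqP; split=> [p pG|p []//]; split=> //.
  by exists (p 0%N) => // i; rewrite leqn0 => /eqP ->.
rewrite E.
have [|| mU muU] := measure_bigcup_finType (path_measure D s)
  (F := fun t => cylinder D (fun=> t) 0 `&` hits D G 0 n).
- by move=> t; have [] := cylinder_hits D G s n (fun=> t) 0.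
- apply/trivIsetP => t t' _ _ /eqP tt'; apply/seteqP; split=> // p.
  by move=> [[/(_ _ (leqnn _)) pt _] [/(_ _ (leqnn _)) pt' _]]; apply: tt';
    rewrite -pt.
split=> //; rewrite muU (bigD1 s) //= big1 => [|t ts].
  have [_ ->] := cylinder_hits D G s n (fun=> s) 0.
  by rewrite path_measureP eqxx big_ord0 mulr1 mul1e adde0.
have [_ ->] := cylinder_hits D G s n (fun=> t) 0.
by rewrite path_measureP (negbTE ts) mul0r mul0e.
Qed.

Lemma reach_within_le1 (R : realType) (S : finType) (D : markov_chain R S)
  (G : {set S}) (n : nat) (s : S) : 0 <= reach_within D G n s <= 1.
Proof.
have [mh h] := measure_hits D G s n.
by rewrite -!lee_fin -h measure_ge0 probability_le1.
Qed.

Lemma reach_within_homo (R : realType) (S : finType) (D : markov_chain R S)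
  (G : {set S}) (s : S) :
  {homo (reach_within D G)^~ s : n m / (n <= m)%N >-> n <= m}.
Proof.
move=> n m nm; rewrite -lee_fin.
have [mn <-] := measure_hits D G s n.
have [mm <-] := measure_hits D G s m.
apply: le_measure; rewrite ?inE // => p [i lin piG].
by exists i => //; exact: leq_trans nm.
Qed.

(** * The reachability probability as a limit and a fixed point *)

Definition reach_value (R : realType) (S : finType) (D : markov_chain R S)
  (G : {set S}) (s : S) : R := fine (reach_prob D G s).

(** Continuity of the measure from below along the increasing events [hits D G 0 n], whose union is
    [reach D G]. *)
Lemma reach_within_cvg_prob (R : realType) (S : finType) (D : markov_chain R S)
  (G : {set S}) (s : S) :
  (reach_within D G n s)%:E @[n --> \oo] --> reach_prob D G s /\
  reach_prob D G s \is a fin_num.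
Proof.
have mh n := (measure_hits D G s n).1.
have E : reach D G = \bigcup_n hits D G 0 n.
  apply/seteqP; split=> [p [i piG]|p [n _ [i _ piG]]]; last by exists i.
  by exists i => //; exists i.
have mE : measurable (\bigcup_n hits D G 0 n) by exact: bigcup_measurable.
rewrite /reach_prob E; split; last exact: fin_num_measure.
have := @nondecreasing_cvg_mu _ _ _ (path_measure D s) _ mh mE.
rewrite (_ : _ \o _ = fun n => (reach_within D G n s)%:E); last first.
  by apply/funext => n /=; have [] := measure_hits D G s n.
apply => n m nm; apply/subsetPset => p [i lin piG].
by exists i => //; exact: leq_trans nm.
Qed.

Lemma reach_valueE (R : realType) (S : finType) (D : markov_chain R S)
  (G : {set S}) (s : S) : reach_prob D G s = (reach_value D G s)%:E.
Proof. by rewrite fineK //; have [] := reach_within_cvg_prob D G s. Qed.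

Lemma reach_within_cvg (R : realType) (S : finType) (D : markov_chain R S)
  (G : {set S}) (s : S) :
  reach_within D G n s @[n --> \oo] --> reach_value D G s.
Proof.
have [/[swap] _] := reach_within_cvg_prob D G s.
by rewrite reach_valueE => /fine_cvgP[].
Qed.

Lemma reach_within_le_value (R : realType) (S : finType) (D : markov_chain R S)
  (G : {set S}) (n : nat) (s : S) : reach_within D G n s <= reach_value D G s.
Proof.
have c := @reach_within_cvg _ _ D G s.
rewrite -(cvg_lim (@Rhausdorff R) c).
apply: nondecreasing_cvgn_le; first exact: reach_within_homo.
by apply/cvg_ex; eexists; exact: c.
Qed.

Lemma reach_value_target (R : realType) (S : finType) (D : markov_chain R S)
  (G : {set S}) (s : S) : s \in G -> reach_value D G s = 1.
Proof.
move=> sG; apply: (cvg_unique _ (@reach_within_cvg _ _ D G s)) => //.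
rewrite (_ : reach_within D G ^~ s = fun=> 1); first exact: cvg_cst.
by apply/funext => -[|n] /=; rewrite sG.
Qed.

Lemma reach_value_step (R : realType) (S : finType) (D : markov_chain R S)
  (G : {set S}) (s : S) : s \notin G ->
  reach_value D G s = \sum_t trans D s t * reach_value D G t.
Proof.
move=> sG; apply: (cvg_unique _ (@reach_within_cvg _ _ D G s)) => //.
(* The shifted sequence unfolds to a finite weighted sum of the unshifted ones, so the limit passes
   inside. *)
rewrite /= -(cvg_shiftS (reach_within D G ^~ s)) /= (negbTE sG).
apply: cvg_big => [|t _]; first exact: add_continuous.
by apply: cvgM; [exact: cvg_cst|exact: reach_within_cvg].
Qed.

(** * The iterates [svi_x] and [svi_y] and the estimates they give *)

Lemma reach_value_zero (R : realType) (S : finType) (D : markov_chain R S)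
  (G : {set S}) (s : S) : (s \in S_zero D G) = (reach_value D G s == 0).
Proof. by rewrite inE reach_valueE eqe. Qed.

(** The two recursions differ only on [S_zero], where [svi_f] imposes 0; there [reach_within] is
    squeezed between 0 and a zero limit. *)
Lemma svi_xE (R : realType) (S : finType) (D : markov_chain R S)
  (G : {set S}) (n : nat) (s : S) : svi_x D G n s = reach_within D G n s.
Proof.
elim: n s => [|n IH] s; first by rewrite /svi_x /=; case: ifP.
rewrite /svi_x iterS {1}/svi_f /=; case: ifPn => [|_].
  rewrite reach_value_zero => /eqP v0.
  have := reach_within_le_value D G n.+1 s.
  have /andP[q0 _] := reach_within_le1 D G n.+1 s.
  by rewrite v0 => q1; apply/eqP; rewrite eq_le q0 q1.
case: ifP => // _; apply: eq_bigr => t _; congr (_ * _); exact: IH.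
Qed.

Lemma mem_S_unknown (R : realType) (S : finType) (D : markov_chain R S)
  (G : {set S}) (s : S) :
  (s \in S_unknown D G) = (reach_value D G s != 0) && (s \notin G).
Proof. by rewrite !inE negb_or -reach_value_zero inE andbT. Qed.

Lemma svi_y_step (R : realType) (S : finType) (D : markov_chain R S)
  (G : {set S}) (n : nat) (s : S) : svi_y D G n.+1 s =
  if s \in S_unknown D G then \sum_t trans D s t * svi_y D G n t else 0.
Proof. by []. Qed.

Lemma svi_y_out (R : realType) (S : finType) (D : markov_chain R S)
  (G : {set S}) (n : nat) (s : S) :
  s \notin S_unknown D G -> svi_y D G n s = 0.
Proof.
case: n => [|n] sU; last by rewrite svi_y_step (negbTE sU).
by rewrite /svi_y /= (negbTE sU).
Qed.

Lemma svi_y_ge0 (R : realType) (S : finType) (D : markov_chain R S)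
  (G : {set S}) (n : nat) (s : S) : 0 <= svi_y D G n s.
Proof.
elim: n s => [|n IH] s; first exact: ler0n.
rewrite svi_y_step; case: ifP => // _.
by apply: sumr_ge0 => t _; rewrite mulr_ge0 ?trans_ge0.
Qed.

Lemma ler_trans_sum (R : realType) (S : finType) (D : markov_chain R S)
  (s : S) (f g : S -> R) : (forall t, f t <= g t) ->
  \sum_t trans D s t * f t <= \sum_t trans D s t * g t.
Proof.
by move=> fg; apply: ler_sum => t _; rewrite ler_wpM2l ?trans_ge0.
Qed.

(** Having reached [G] within [n] steps and having stayed in [S_unknown] are disjoint events. *)
Lemma reach_within_svi_y_le1 (R : realType) (S : finType) (D : markov_chain R S)
  (G : {set S}) (n : nat) (s : S) :
  reach_within D G n s + svi_y D G n s <= 1.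
Proof.
have [sU|sU] := boolP (s \in S_unknown D G); last first.
  by rewrite svi_y_out // addr0; have /andP[] := reach_within_le1 D G n s.
elim: n s sU => [|n IH] s sU.
  have := sU; rewrite mem_S_unknown => /andP[_ /negbTE sG].
  by rewrite /svi_y /= sG sU add0r.
have := sU; rewrite mem_S_unknown => /andP[_ /negbTE sG].
rewrite svi_y_step sU /= sG -big_split /= -(trans_sum1 D s).
apply: ler_sum => t _; rewrite -mulrDr ler_piMr ?trans_ge0 //.
have [tU|tU] := boolP (t \in S_unknown D G); first exact: IH.
by rewrite svi_y_out // addr0; have /andP[] := reach_within_le1 D G n t.
Qed.

(** Unroll the fixed-point equation [n] times: the mass [svi_y] not yet decided sits on [S_unknown],
    where the value is at least [a]. *)
Lemma svi_lower (R : realType) (S : finType) (D : markov_chain R S)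
  (G : {set S}) (a : R) (n : nat) :
  (forall s, s \in S_unknown D G -> a <= reach_value D G s) ->
  forall s, reach_within D G n s + svi_y D G n s * a <= reach_value D G s.
Proof.
move=> ale; elim: n => [|n IH] s.
  rewrite /svi_y /=; case: ifPn => sG.
    by rewrite mem_S_unknown sG andbF mul0r addr0 reach_value_target.
  have [sU|_] := boolP (s \in S_unknown D G); first by rewrite add0r mul1r ale.
  rewrite mul0r addr0 (le_trans _ (reach_within_le_value D G 0 s)) //=.
  by rewrite (negbTE sG).
have [sU|sU] := boolP (s \in S_unknown D G); last first.
  by rewrite svi_y_out // mul0r addr0 reach_within_le_value.
have := sU; rewrite mem_S_unknown => /andP[_ sG].
rewrite svi_y_step sU /= (negbTE sG) reach_value_step //.
rewrite mulr_suml -big_split /=.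
rewrite (eq_bigr (fun t => trans D s t *
  (reach_within D G n t + svi_y D G n t * a))) => [|t _].
  exact: ler_trans_sum.
by rewrite mulrDr mulrA.
Qed.

Lemma svi_upper (R : realType) (S : finType) (D : markov_chain R S)
  (G : {set S}) (b : R) (n : nat) :
  (forall s, s \in S_unknown D G -> reach_value D G s <= b) ->
  forall s, reach_value D G s <= reach_within D G n s + svi_y D G n s * b.
Proof.
move=> leb.
(* Unlike the lower bound, the upper one needs equality off [S_unknown]: there the value is 0, or it
   is 1 and attained at step 0. *)
have out m s : s \notin S_unknown D G ->
    reach_value D G s = reach_within D G m s.
  rewrite mem_S_unknown negb_and !negbK => /orP[/eqP v0|sG].
    have := reach_within_le_value D G m s.
    have /andP[q0 _] := reach_within_le1 D G m s.
    by rewrite v0 => q1; apply/eqP; rewrite eq_le q0 q1.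
  by rewrite reach_value_target //; case: m => [|m] /=; rewrite sG.
elim: n => [|n IH] s; have [sU|sU] := boolP (s \in S_unknown D G).
- have := sU; rewrite mem_S_unknown => /andP[_ /negbTE sG].
  by rewrite /svi_y /= sG sU add0r mul1r leb.
- by rewrite svi_y_out // mul0r addr0 (out 0%N).
- have := sU; rewrite mem_S_unknown => /andP[_ sG].
  rewrite svi_y_step sU /= (negbTE sG) reach_value_step //.
  rewrite mulr_suml -big_split /=.
  rewrite [leRHS](eq_bigr (fun t => trans D s t *
    (reach_within D G n t + svi_y D G n t * b))) => [|t _].
    exact: ler_trans_sum.
  by rewrite mulrDr mulrA.
- by rewrite svi_y_out // mul0r addr0 (out n.+1).
Qed.

(** * Geometric decay of [svi_y] *)

Lemma svi_y_lt1 (R : realType) (S : finType) (D : markov_chain R S)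
  (G : {set S}) :
  exists N, forall s, s \in S_unknown D G -> svi_y D G N s < 1.
Proof.
(* A positive limit forces a positive term at each state of [S_unknown]; by monotonicity the maximum
   of these finitely many indices serves all states at once. *)
have /fin_all_exists[n nP] (s : S) :
    exists n, s \in S_unknown D G -> 0 < reach_within D G n s.
  have [|sU] := boolP (s \in S_unknown D G); last by exists 0%N.
  rewrite mem_S_unknown => /andP[v0 _]; apply: contrapT => /forallNP H.
  move/eqP: v0; apply.
  apply: (cvg_unique _ (@reach_within_cvg _ _ D G s)) => //.
  rewrite (_ : reach_within D G ^~ s = fun=> 0); first exact: cvg_cst.
  apply/funext => m; have /andP[q0 _] := reach_within_le1 D G m s.
  apply/eqP; rewrite eq_le q0 andbT leNgt; apply/negP => qm.
  by apply: (H m).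
exists (\max_s n s)%N => s sU.
have := reach_within_svi_y_le1 D G (\max_s n s)%N s.
have := reach_within_homo D G s (leq_bigmax (F := n) s).
have := nP s sU; lra.
Qed.

Lemma svi_y_geometric (R : realType) (S : finType) (D : markov_chain R S)
  (G : {set S}) (c : R) (N : nat) :
  (forall s, s \in S_unknown D G -> svi_y D G N s <= c) ->
  forall m s, s \in S_unknown D G -> svi_y D G (m * N) s <= c ^+ m.
Proof.
move=> yc; elim=> [|m IH] s sU; first by rewrite mul0n /svi_y /= sU expr0.
have c0 : 0 <= c by exact: le_trans (svi_y_ge0 D G N s) (yc s sU).
(* By linearity of the recursion, the bound for [k = 0], where [svi_y] is the indicator of
   [S_unknown], propagates to every [k]. *)
have le_c k t : svi_y D G (k + N) t <= c * svi_y D G k t.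
  elim: k t => [|k IHk] t; have [tU|tU] := boolP (t \in S_unknown D G).
  - by rewrite {2}/svi_y /= tU mulr1 yc.
  - by rewrite !svi_y_out // mulr0.
  - rewrite addSn !svi_y_step tU mulr_sumr.
    apply: (le_trans (ler_trans_sum D t IHk)).
    by apply: ler_sum => u _; rewrite mulrCA.
  - by rewrite !svi_y_out // mulr0.
rewrite mulSnr exprS (le_trans (le_c _ _)) // ler_wpM2l //; exact: IH.
Qed.

(** The requirement [N < n] lets termination wait until both bounds are finite. *)
Lemma svi_y_small (R : realType) (S : finType) (D : markov_chain R S)
  (G : {set S}) (s : S) (N : nat) (e : R) : 0 < e ->
  exists2 n, (N < n)%N & svi_y D G n s < e.
Proof.
move=> e0; have [sU|sU] := boolP (s \in S_unknown D G); last first.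
  by exists N.+1; rewrite ?svi_y_out.
have [M yM] := svi_y_lt1 D G.
have M0 : (0 < M)%N.
  by case: M yM => // /(_ s sU); rewrite /svi_y /= sU ltxx.
(* The default 0 is harmless: [svi_y] is nonnegative, and 0 is below 1. *)
pose c := \big[Order.max/0]_(t in S_unknown D G) svi_y D G M t.
have yc t : t \in S_unknown D G -> svi_y D G M t <= c.
  by move=> tU; exact: le_bigmax_cond.
have c0 : 0 <= c by exact: le_trans (svi_y_ge0 D G M s) (yc s sU).
have c1 : c < 1 by apply: bigmax_lt.
have /cvg_expr/cvgr0_norm_lt/(_ _ e0)[m _ mP] : `|c| < 1 by rewrite ger0_norm.
(* The exponent is at least [m], for smallness, and at least [N.+1]; as [M] is positive, the index
   then exceeds [N]. *)
exists (maxn m N.+1 * M)%N.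
  by apply: leq_trans (leq_pmulr _ M0); rewrite leq_maxr.
apply: le_lt_trans (svi_y_geometric yc _ sU) _.
by have := mP _ (leq_maxl m N.+1); rewrite /= ger0_norm // exprn_ge0.
Qed.

(** * The bounds [svi_l] and [svi_u] *)

Lemma svi_l_step (R : realType) (S : finType) (D : markov_chain R S)
  (G : {set S}) (k : nat) : svi_l D G k.+1 =
  if [forall s in S_unknown D G, svi_y D G k.+1 s < 1] then
    Order.max (svi_l D G k) (\big[Order.min/+oo%E]_(s in S_unknown D G)
      (svi_x D G k.+1 s / (1 - svi_y D G k.+1 s))%:E)
  else svi_l D G k.
Proof. by rewrite /svi_l /=; case: (svi_bounds D G k) => l u; case: ifP. Qed.

Lemma svi_u_step (R : realType) (S : finType) (D : markov_chain R S)
  (G : {set S}) (k : nat) : svi_u D G k.+1 =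
  if [forall s in S_unknown D G, svi_y D G k.+1 s < 1] then
    Order.min (svi_u D G k) (\big[Order.max/-oo%E]_(s in S_unknown D G)
      (svi_x D G k.+1 s / (1 - svi_y D G k.+1 s))%:E)
  else svi_u D G k.
Proof. by rewrite /svi_u /=; case: (svi_bounds D G k) => l u; case: ifP. Qed.

Lemma svi_l_homo (R : realType) (S : finType) (D : markov_chain R S)
  (G : {set S}) : {homo svi_l D G : m n / (m <= n)%N >-> (m <= n)%E}.
Proof.
apply: homo_leq => [//|x y z|k]; first exact: le_trans.
by rewrite svi_l_step; case: ifP => // _; rewrite le_max lexx.
Qed.

Lemma svi_u_homo (R : realType) (S : finType) (D : markov_chain R S)
  (G : {set S}) : {homo svi_u D G : m n / (m <= n)%N >-> (n <= m)%E}.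
Proof.
apply: homo_leq => [//|x y z yx zy|k]; first exact: le_trans yx.
by rewrite svi_u_step; case: ifP => // _; rewrite ge_min lexx.
Qed.

(* At a state s of S_unknown where Pr_s(reach G) is minimal (resp. maximal),
   svi_lower (resp. svi_upper) becomes self-referential and solves to a bound
   on Pr_s(reach G) by x_k(s) / (1 - y_k(s)). *)
Lemma svi_bounds_value (R : realType) (S : finType) (D : markov_chain R S)
  (G : {set S}) (k : nat) (s : S) : s \in S_unknown D G ->
  (svi_l D G k <= (reach_value D G s)%:E)%E /\
  ((reach_value D G s)%:E <= svi_u D G k)%E.
Proof.
move=> sU; elim: k => [|k [IHl IHu]]; first by rewrite leNye leey.
rewrite svi_l_step svi_u_step; case: ifPn => [/forall_inP y1|//].
rewrite ge_max le_min IHl IHu !andTb; split.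
  have [t tU tmin] := arg_minP (reach_value D G) sU.
  have y1t := y1 t tU.
  apply: le_trans (bigmin_le_cond _ _ tU) _; rewrite lee_fin.
  apply: le_trans (tmin s sU); rewrite ler_pdivrMr ?subr_gt0 // svi_xE.
  by have := svi_lower k.+1 tmin t; lra.
have [t tU tmax] := arg_maxP (reach_value D G) sU.
have y1t := y1 t tU.
apply: le_trans _ (le_bigmax_cond _ _ tU); rewrite lee_fin.
apply: le_trans (tmax s sU) _; rewrite ler_pdivlMr ?subr_gt0 // svi_xE.
by have := svi_upper k.+1 tmax t; lra.
Qed.

(** Once [svi_y] is below 1 on [S_unknown], the update by extrema of finitely many reals excludes
    [-oo] for the lower and [+oo] for the upper bound; the sandwich [svi_bounds_value] excludes the
    opposite infinities. *)
Lemma svi_bounds_fin (R : realType) (S : finType) (D : markov_chain R S)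
  (G : {set S}) (s : S) : s \in S_unknown D G ->
  exists N (a b : R), svi_l D G N = a%:E /\ svi_u D G N = b%:E.
Proof.
move=> sU; have [[|N] y1] := svi_y_lt1 D G.
  by have := y1 s sU; rewrite /svi_y /= sU ltxx.
exists N.+1.
have [] := svi_bounds_value N.+1 sU.
have : (-oo < svi_l D G N.+1)%E.
  rewrite svi_l_step ifT; last exact/forall_inP.
  by rewrite lt_max (lt_bigmin _ _) ?orbT // => t _; rewrite ltNyr.
have : (svi_u D G N.+1 < +oo)%E.
  rewrite svi_u_step ifT; last exact/forall_inP.
  by rewrite gt_min (bigmax_lt _ _) ?orbT // => t _; rewrite ltry.
case: (svi_l D G N.+1) => [a| |] //.
case: (svi_u D G N.+1) => [b| |] // _ _ _ _.
by exists a, b.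
Qed.

(** * Termination and correctness *)

Lemma svi_stops (R : realType) (S : finType) (D : markov_chain R S)
  (G : {set S}) (eps : R) : 0 < eps ->
  exists2 k, (0 < k)%N & svi_stop D G eps k.
Proof.
move=> e0; have [sU|sU] := boolP (init D \in S_unknown D G); last first.
  (* Here the weight is 0, so the product is 0 even if the gap is infinite. *)
  by exists 1%N; rewrite // /svi_stop svi_y_out // mul0e lte_fin mulr_gt0.
have [N [a [b [la ub]]]] := svi_bounds_fin sU.
have ab : a <= b.
  have [] := svi_bounds_value N sU; rewrite la ub !lee_fin; exact: le_trans.
(* Adding 1 keeps the divisor positive when [a = b]. *)
have C0 : 0 < b - a + 1 by lra.
have d0 : 0 < 2 * eps / (b - a + 1) by rewrite divr_gt0 // mulr_gt0.
have [n Nn yn] := svi_y_small D G (init D) N d0.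
exists n; first exact: leq_ltn_trans Nn.
have y0 := svi_y_ge0 D G n (init D).
(* Past [N] the gap only shrinks, so it is at most [b - a]. *)
rewrite /svi_stop; apply: (@le_lt_trans _ _
    ((svi_y D G n (init D))%:E * (b%:E - a%:E))%E).
  rewrite lee_wpmul2l ?lee_fin //; apply: leeB.
    by rewrite -ub svi_u_homo // ltnW.
  by rewrite -la svi_l_homo // ltnW.
rewrite -EFinB -EFinM lte_fin.
by move: yn; rewrite ltr_pdivlMr //; lra.
Qed.

Lemma svi_stop_correct (R : realType) (S : finType) (D : markov_chain R S)
  (G : {set S}) (eps : R) (k : nat) : 0 < eps -> svi_stop D G eps k ->
  (`| svi_result D G k - reach_prob D G (init D) | < eps%:E)%E.
Proof.
move=> e0; rewrite /svi_stop /svi_result reach_valueE svi_xE.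
have y0 := svi_y_ge0 D G k (init D).
have [yz _|yN0] := eqVneq (svi_y D G k (init D)) 0.
  rewrite yz mul0e adde0 -EFinB abse_EFin lte_fin.
  (* Any upper bound on the values would do: its coefficient [svi_y] is 0, which forces
     [reach_within] to equal the value. *)
  have := @svi_upper _ _ D G (\big[Order.max/0]_s reach_value D G s) k
    (fun s _ => le_bigmax _ _ s) (init D).
  rewrite yz mul0r addr0 => h; have := reach_within_le_value D G k (init D).
  by move=> h'; rewrite ltr_norml; apply/andP; split; lra.
have yp : 0 < svi_y D G k (init D) by rewrite lt_neqAle eq_sym yN0.
have sU : init D \in S_unknown D G.
  by apply: contraNT yN0 => sU; rewrite svi_y_out.
have bnd s := @svi_bounds_value _ _ D G k s.
have [] := bnd _ sU; move: bnd.
(* A lower bound [-oo] or an upper bound [+oo] makes the gap infinite, and with positive weight the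
   test fails; the remaining infinities contradict the sandwich. *)
case: (svi_l D G k) => [a| |] //; case: (svi_u D G k) => [b| |] //= bnd _ _;
  rewrite ?gt0_muley ?lte_fin //.
have lower := @svi_lower _ _ D G a k (fun s sU => (bnd s sU).1) (init D).
have upper := @svi_upper _ _ D G b k (fun s sU => (bnd s sU).2) (init D).
(* The value lies in an interval centred at the result, of width [svi_y * (b - a)], which is below
   [2 * eps]. *)
move=> h; rewrite ltr_norml; apply/andP; split; lra.
Qed.

Theorem theorem2 (R : realType) (S : finType) (D : markov_chain R S)
  (G : {set S}) (absG : forall s, s \in G -> absorbing D s)
  (eps : R) (eps_gt0 : 0 < eps) :
  (exists r, svi_returns D G eps r) /\
  (forall r, svi_returns D G eps r ->
    (`| r - reach_prob D G (init D) | < eps%:E)%E).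
Proof.
split=> [|r [k [_ stop _ ->]]]; last exact: svi_stop_correct.
have ex : exists k, (0 < k)%N && svi_stop D G eps k.
  by have [k k0 stop] := svi_stops D G eps_gt0; exists k; rewrite k0.
(* The loop exits at the least passing index, not at the one supplied by [svi_stops]. *)
case: (ex_minnP ex) => k /andP[k0 stop] kmin.
exists (svi_result D G k), k; split=> // j /andP[j0 jk].
by apply: contraL jk => stopj; rewrite -leqNgt kmin // j0.
Qed.
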